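(* Let $\pi\in\{\pi_1,\pi_2,\pi_3,\pi_{41},\pi_{42}\}$ be any of the five coalition structures, and let $v_1^\pi,v_2^\pi,v_3^\pi$ be the associated environmentally sustainable strategies defined in the context. Consider $$\dot z^{\pi}(t)=\sum_{i=1}^{3}\xi_i v_i^{\pi}(t)-\delta(t)z^{\pi}(t),\qquad z^{\pi}(0)=z_0^{\pi}.$$ Then there is a unique hybrid limit cycle $\bar z^{\pi}(t)$ of this equation (a $T$-periodic solution), and for every initial state $z_0^{\pi}\ge 0$ the solution $z^{\pi}(t)$ converges exponentially to $\bar z^{\pi}(t)$ as $t\to\infty$, i.e. there are constants $C\ge 0$, $\alpha>0$ with $|z^{\pi}(t)-\bar z^{\pi}(t)|\le Ce^{-\alpha t}$ for all $t\ge 0$.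
   Context: Three players $i=1,2,3$ (1 and 2 ''farsighted'', 3 ''myopic''). Constants: $a_i,b_i,\xi_i>0$ for $i=1,2,3$; $q_1,q_2>0$, $q:=q_1+q_2$; $\rho>0$, $T>0$, $\tau\in(0,1)$, $\delta_1,\delta_2>0$. The function $\delta$ is $T$-periodic and piecewise constant: for $k\in\mathbb N_0$, $\delta(t)=\delta_1$ for $t\in[kT,(k+\tau)T)$ and $\delta(t)=\delta_2$ for $t\in[(k+\tau)T,(k+1)T)$. Solutions of the differential equation are continuous and satisfy it except at switching times. Put $s_1=\delta_1+\rho$, $s_2=\delta_2+\rho$, $$m_1=\frac{(s_2-s_1)(1-e^{s_2T(\tau-1)})}{s_1s_2(e^{s_1\tau T}-e^{s_2T(\tau-1)})},\qquad m_2=e^{-s_2T}\Big(m_1-\frac1{s_1}+\frac1{s_2}\Big),$$ and for $k\in\mathbb N_0$ $$L(t)=\begin{cases}m_1e^{s_1(t-kT)}-\frac1{s_1},&t\in[kT,(k+\tau)T],\\ m_2e^{s_2(t-kT)}-\frac1{s_2},&t\in[(k+\tau)T,(k+1)T].\end{cases}$$ ($L$ is the $T$-periodic solution of $\dot L=1+(\rho+\delta(t))L$.) Coalition structures: $\pi_1=\{\{1,2,3\}\}$, $\pi_2=\{\{1\},\{2\},\{3\}\}$, $\pi_3=\{\{1,2\},\{3\}\}$, $\pi_{41}=\{\{1,3\},\{2\}\}$, $\pi_{42}=\{\{2,3\},\{1\}\}$. The strategies are $$v_i^{\pi}(t)=b_i+\frac{\xi_i}{a_i}\,c_i^{\pi}L(t),\qquad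 i=1,2,3,$$ with $(c_1^{\pi},c_2^{\pi},c_3^{\pi})$ equal to $(q,q,q)$ for $\pi_1$; $(q_1,q_2,0)$ for $\pi_2$; $(q,q,0)$ for $\pi_3$; $(q_1,q_2,q_1)$ for $\pi_{41}$; $(q_1,q_2,q_2)$ for $\pi_{42}$. Standing assumption (environmental sustainability): $c_i^{\pi}L(t)\in[-a_ib_i/\xi_i,0]$ for all $t>0$, all $i$ and all five $\pi$, so that $v_i^\pi(t)\in[0,b_i]$. ''Hybrid limit cycle'' means a $T$-periodic trajectory of the switched (hybrid) system. *)

(* Defs.v *)
From Stdlib Require Import Reals Lra Lia.
From Coquelicot Require Import Coquelicot.
Open Scope R_scope.

Inductive player := P1 | P2 | P3.

(* pi1 = {{1,2,3}}, pi2 = {{1},{2},{3}}, pi3 = {{1,2},{3}},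
   pi41 = {{1,3},{2}}, pi42 = {{2,3},{1}}. *)
Inductive coalition_structure := pi1 | pi2 | pi3 | pi41 | pi42.

Record game := Game {
  a : player -> R;
  b : player -> R;
  xi : player -> R;
  q1 : R;
  q2 : R;
  rho : R;
  T : R;
  tau : R;
  delta1 : R;
  delta2 : R
}.

Definition q (G : game) : R := q1 G + q2 G.
Definition s1 (G : game) : R := delta1 G + rho G.
Definition s2 (G : game) : R := delta2 G + rho G.

(* For t >= 0 this is the k in N_0 with k T <= t < (k+1) T: [Int_part] is the
   floor function. *)
Definition period_index (G : game) (t : R) : R := IZR (Int_part (t / T G)).

Definition delta (G : game) (t : R) : R :=
  if Rlt_dec t ((period_index G t + tau G) * T G) then delta1 G else delta2 G.

Definition m1 (G : game) : R :=
  (s2 G - s1 G) * (1 - exp (s2 G * T G * (tau G - 1)))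
  / (s1 G * s2 G
     * (exp (s1 G * tau G * T G) - exp (s2 G * T G * (tau G - 1)))).

Definition m2 (G : game) : R :=
  exp (- s2 G * T G) * (m1 G - 1 / s1 G + 1 / s2 G).

(* The branches are taken on half-open intervals; [L_first] and [L_second]
   below show that both formulas hold on the closed intervals. *)
Definition L (G : game) (t : R) : R :=
  let k := period_index G t in
  if Rlt_dec t ((k + tau G) * T G)
  then m1 G * exp (s1 G * (t - k * T G)) - 1 / s1 G
  else m2 G * exp (s2 G * (t - k * T G)) - 1 / s2 G.

Definition coeff (G : game) (pi : coalition_structure) (i : player) : R :=
  match pi, i with
  | pi1, _ => q G
  | pi2, P1 => q1 G
  | pi2, P2 => q2 G
  | pi2, P3 => 0
  | pi3, P1 => q G
  | pi3, P2 => q G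
  | pi3, P3 => 0
  | pi41, P1 => q1 G
  | pi41, P2 => q2 G
  | pi41, P3 => q1 G
  | pi42, P1 => q1 G
  | pi42, P2 => q2 G
  | pi42, P3 => q2 G
  end.

Definition strategy (G : game) (pi : coalition_structure) (i : player) (t : R)
  : R := b G i + xi G i / a G i * coeff G pi i * L G t.

Definition environmentally_sustainable (G : game) : Prop :=
  forall (pi : coalition_structure) (i : player) (t : R), 0 < t ->
    - (a G i * b G i / xi G i) <= coeff G pi i * L G t <= 0.

Definition rhs (G : game) (pi : coalition_structure) (t z : R) : R :=
  xi G P1 * strategy G pi P1 t + xi G P2 * strategy G pi P2 t
  + xi G P3 * strategy G pi P3 t - delta G t * z.

Definition switching_time (G : game) (t : R) : Prop :=
  exists k : nat, t = INR k * T G \/ t = (INR k + tau G) * T G.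

(* Trajectories live on [0, oo); the values of z at negative times are
   irrelevant, so trajectories are compared on [0, oo) only. *)
Definition is_trajectory (G : game) (pi : coalition_structure) (z : R -> R)
  : Prop :=
  continuous_on (fun t => 0 <= t) z /\
  forall t : R, 0 < t -> ~ switching_time G t -> is_derive z t (rhs G pi t (z t)).

Definition is_hybrid_limit_cycle (G : game) (pi : coalition_structure)
    (z : R -> R) : Prop :=
  is_trajectory G pi z /\ forall t : R, 0 <= t -> z (t + T G) = z t.

Definition converges_exponentially (z w : R -> R) : Prop :=
  exists C alpha : R, 0 <= C /\ 0 < alpha /\
    forall t : R, 0 <= t -> Rabs (z t - w t) <= C * exp (- alpha * t).

Lemma period_index_eq (G : game) (k : nat) (t : R) :
  0 < T G -> INR k * T G <= t < (INR k + 1) * T G -> period_index G t = INR k.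
Proof.
intros HT [H1 H2]; unfold period_index.
rewrite INR_IZR_INZ; f_equal; symmetry; apply Int_part_spec.
rewrite <- INR_IZR_INZ.
assert (E : t = t / T G * T G) by (field; lra).
rewrite E in H1, H2.
apply Rmult_le_reg_r in H1; [|lra]; apply Rmult_lt_reg_r in H2; lra.
Qed.

Lemma L_first (G : game) (k : nat) (t : R) :
  0 < s1 G -> 0 < s2 G -> 0 < T G -> 0 < tau G < 1 ->
  INR k * T G <= t <= (INR k + tau G) * T G ->
  L G t = m1 G * exp (s1 G * (t - INR k * T G)) - 1 / s1 G.
Proof.
intros Hs1 Hs2 HT Htau Ht.
assert (Hk : period_index G t = INR k) by (apply period_index_eq; nra).
unfold L; rewrite Hk; destruct (Rlt_dec _ _) as [|Hn]; [reflexivity|].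
replace (t - INR k * T G) with (tau G * T G) by nra.
unfold m2.
replace (exp (- s2 G * T G) * (m1 G - 1 / s1 G + 1 / s2 G)
         * exp (s2 G * (tau G * T G)))
  with ((exp (- s2 G * T G) * exp (s2 G * (tau G * T G)))
         * (m1 G - 1 / s1 G + 1 / s2 G)) by ring.
rewrite <- exp_plus.
replace (- s2 G * T G + s2 G * (tau G * T G))
  with (s2 G * T G * (tau G - 1)) by ring.
replace (s1 G * (tau G * T G)) with (s1 G * tau G * T G) by ring.
assert (Hu : exp (s2 G * T G * (tau G - 1)) < exp (s1 G * tau G * T G)).
{ apply exp_increasing.
  assert (0 < s2 G * T G) by nra. assert (0 < s1 G * tau G) by nra. nra. }
unfold m1; field; lra.
Qed.

Lemma L_second (G : game) (k : nat) (t : R) :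
  0 < s1 G -> 0 < s2 G -> 0 < T G -> 0 < tau G < 1 ->
  (INR k + tau G) * T G <= t <= (INR k + 1) * T G ->
  L G t = m2 G * exp (s2 G * (t - INR k * T G)) - 1 / s2 G.
Proof.
intros Hs1 Hs2 HT Htau Ht.
destruct (Rlt_dec t ((INR k + 1) * T G)) as [Hlt|Hge].
- assert (Hk : period_index G t = INR k) by (apply period_index_eq; nra).
  unfold L; rewrite Hk; destruct (Rlt_dec _ _) as [Hn|]; [lra|reflexivity].
- assert (Et : t = INR (S k) * T G) by (rewrite S_INR; lra).
  rewrite (L_first G (S k) t); [|lra..|rewrite Et; nra].
  replace (t - INR (S k) * T G) with 0 by lra.
  rewrite Et, S_INR.
  replace ((INR k + 1) * T G - INR k * T G) with (T G) by ring.
  unfold m2.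
  replace (exp (- s2 G * T G) * (m1 G - 1 / s1 G + 1 / s2 G) * exp (s2 G * T G))
    with ((exp (- s2 G * T G) * exp (s2 G * T G))
          * (m1 G - 1 / s1 G + 1 / s2 G)) by ring.
  rewrite <- exp_plus, Rmult_0_r.
  replace (- s2 G * T G + s2 G * T G) with 0 by ring.
  rewrite exp_0; ring.
Qed.

(* Main.v *)
(** Two trajectories differ by a multiple of [exp (- D t)], where [D' = delta],
    because their difference times [exp (D t)] is continuous with vanishing
    derivative off the switching times. As [D t] is [mu * t] plus a bounded
    periodic function, with [mu] the mean of [delta], this gives uniqueness and
    exponential convergence at once. Existence of the limit cycle is explicit:
    on each half period the equation has constant [delta] and an elementary
    general solution, and the two free constants are determined by continuity
    and periodicity. *)
Require Import Defs.
From Stdlib Require Import Reals.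
From Coquelicot Require Import Coquelicot.
From Stdlib Require Import Lra Lia ZArith.
Open Scope R_scope.

(** * Periodic gluing of two branches given in local time *)

Definition glue (G : game) (f1 f2 : R -> R) (t : R) : R :=
  let k := period_index G t in
  if Rlt_dec t ((k + tau G) * T G) then f1 (t - k * T G) else f2 (t - k * T G).

(** The two junctions of a period: the switch inside it, and its end, where the next period restarts
    at local time 0. *)
Definition glueable (G : game) (f1 f2 : R -> R) : Prop :=
  f1 (tau G * T G) = f2 (tau G * T G) /\ f2 (T G) = f1 0.

(** Integer indices are used because glued functions are shown continuous on the whole line: just to
    the left of 0 the period index is -1. *)
Lemma period_index_eqZ (G : game) (k : Z) (t : R) :
  0 < T G -> IZR k * T G <= t < (IZR k + 1) * T G -> period_index G t = IZR k.
Proof.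
intros HT [H1 H2]; unfold period_index; f_equal; symmetry; apply Int_part_spec.
assert (E : t = t / T G * T G) by (field; lra).
rewrite E in H1, H2.
apply Rmult_le_reg_r in H1; [|lra]; apply Rmult_lt_reg_r in H2; lra.
Qed.

Lemma period_index_bounds (G : game) (t : R) :
  0 < T G -> period_index G t * T G <= t < (period_index G t + 1) * T G.
Proof.
intros HT; unfold period_index.
destruct (base_Int_part (t / T G)) as [H1 H2].
assert (E : t / T G * T G = t) by (field; lra).
set (r := t / T G) in *; set (k := IZR (Int_part r)) in *; clearbody k; clearbody r.
rewrite <- E; split.
- apply Rmult_le_compat_r; lra.
- apply Rmult_lt_compat_r; lra.
Qed.

(** At the right endpoint the test already selects [f2]; the first junction condition supplies the
    equality there. *)
Lemma glue_first (G : game) (f1 f2 : R -> R) (k : Z) (t : R) :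
  0 < T G -> 0 < tau G < 1 -> glueable G f1 f2 ->
  IZR k * T G <= t <= (IZR k + tau G) * T G ->
  glue G f1 f2 t = f1 (t - IZR k * T G).
Proof.
intros HT Htau [Hm _] Ht.
assert (Hk : period_index G t = IZR k) by (apply period_index_eqZ; nra).
unfold glue; rewrite Hk; destruct (Rlt_dec _ _) as [|Hn]; [reflexivity|].
replace (t - IZR k * T G) with (tau G * T G) by nra.
now rewrite Hm.
Qed.

(** The right endpoint belongs to period [k + 1] at local time 0, where the second junction
    condition applies. *)
Lemma glue_second (G : game) (f1 f2 : R -> R) (k : Z) (t : R) :
  0 < T G -> 0 < tau G < 1 -> glueable G f1 f2 ->
  (IZR k + tau G) * T G <= t <= (IZR k + 1) * T G ->
  glue G f1 f2 t = f2 (t - IZR k * T G).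
Proof.
intros HT Htau Hm Ht.
destruct (Rlt_dec t ((IZR k + 1) * T G)) as [Hlt|Hge].
- assert (Hk : period_index G t = IZR k) by (apply period_index_eqZ; nra).
  unfold glue; rewrite Hk; destruct (Rlt_dec _ _); [lra|reflexivity].
- assert (Et : t = IZR (k + 1) * T G) by (rewrite plus_IZR; lra).
  rewrite (glue_first G f1 f2 (k + 1)); [|easy..|rewrite Et; nra].
  rewrite Et at 1; rewrite Et, plus_IZR.
  replace ((IZR k + 1) * T G - (IZR k + 1) * T G) with 0 by ring.
  replace ((IZR k + 1) * T G - IZR k * T G) with (T G) by ring.
  now destruct Hm.
Qed.

Lemma glue_periodic (G : game) (f1 f2 : R -> R) (t : R) :
  0 < T G -> glue G f1 f2 (t + T G) = glue G f1 f2 t.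
Proof.
intros HT.
assert (Hk : period_index G (t + T G) = period_index G t + 1).
{ pose proof (period_index_bounds G t HT) as Hb.
  unfold period_index at 2; rewrite <- plus_IZR.
  apply period_index_eqZ; [easy|rewrite plus_IZR].
  change (IZR (Int_part (t / T G))) with (period_index G t); lra. }
unfold glue; rewrite Hk.
replace (t + T G - (period_index G t + 1) * T G)
  with (t - period_index G t * T G) by ring.
destruct (Rlt_dec _ _), (Rlt_dec _ _); (reflexivity || (exfalso; lra)).
Qed.

Lemma glue_bounded (G : game) (f1 f2 : R -> R) (M : R) (t : R) :
  0 < T G ->
  (forall s, 0 <= s <= T G -> Rabs (f1 s) <= M) ->
  (forall s, 0 <= s <= T G -> Rabs (f2 s) <= M) ->
  Rabs (glue G f1 f2 t) <= M.
Proof.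
intros HT H1 H2; pose proof (period_index_bounds G t HT) as Hb.
unfold glue; destruct (Rlt_dec _ _); [apply H1|apply H2]; lra.
Qed.

(** * Continuity and derivatives of glued functions *)

Lemma continuous_piecewise (f g h : R -> R) (x e : R) :
  0 < e -> continuous g x -> continuous h x ->
  (forall y, x - e < y <= x -> f y = g y) ->
  (forall y, x <= y < x + e -> f y = h y) ->
  continuous f x.
Proof.
intros He Hg Hh Hfg Hfh P HP.
assert (Eg : f x = g x) by (apply Hfg; lra).
assert (Eh : f x = h x) by (apply Hfh; lra).
assert (Pg : locally x (fun y => P (g y))) by (apply Hg; rewrite <- Eg; exact HP).
assert (Ph : locally x (fun y => P (h y))) by (apply Hh; rewrite <- Eh; exact HP).
assert (Hb : locally x (fun y => Rabs (y - x) < e)) by (exists (mkposreal e He); easy).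
change (locally x (fun y => P (f y))).
generalize (filter_and _ _ Hb (filter_and _ _ Pg Ph)).
apply filter_imp; intros y [Hy [Py1 Py2]].
apply Rabs_def2 in Hy.
destruct (Rle_lt_dec y x).
- rewrite Hfg; [easy|lra].
- rewrite Hfh; [easy|lra].
Qed.

Lemma continuous_shift (f : R -> R) (c x : R) :
  (forall s, continuous f s) -> continuous (fun t => f (t - c)) x.
Proof.
intros Hf; apply (continuous_comp (fun t => t - c) f); [|apply Hf].
apply (continuous_minus (V := R_NormedModule)).
- apply continuous_id.
- apply continuous_const.
Qed.

(** The branch formulas hold on closed intervals, so every point has one formula on its left and one
    on its right, both valid at the point itself. The cases are period start, first branch, switch
    and second branch. *)
Lemma glue_continuous (G : game) (f1 f2 : R -> R) (t : R) :
  0 < T G -> 0 < tau G < 1 -> glueable G f1 f2 ->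
  (forall s, continuous f1 s) -> (forall s, continuous f2 s) ->
  continuous (glue G f1 f2) t.
Proof.
intros HT Htau Hm C1 C2.
pose proof (period_index_bounds G t HT) as Hb; unfold period_index in Hb.
set (k := Int_part (t / T G)) in Hb; clearbody k.
assert (P1 : 0 < tau G * T G) by nra.
assert (P2 : 0 < (1 - tau G) * T G) by nra.
destruct (Rtotal_order t ((IZR k + tau G) * T G)) as [Hlt|[Heq|Hgt]].
- destruct (Req_dec t (IZR k * T G)) as [Heq|Hne].
  (* To the left of a period start lies the second branch of the previous period. The radius is the
     shorter branch length, so neither side leaves its branch. *)
  + apply (continuous_piecewise _ (fun y => f2 (y - IZR (k - 1) * T G))
      (fun y => f1 (y - IZR k * T G)) t (Rmin (tau G * T G) ((1 - tau G) * T G))).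
    * now apply Rmin_pos.
    * now apply continuous_shift.
    * now apply continuous_shift.
    * intros y Hy; pose proof (Rmin_r (tau G * T G) ((1 - tau G) * T G)).
      apply glue_second; try easy; rewrite minus_IZR; lra.
    * intros y Hy; pose proof (Rmin_l (tau G * T G) ((1 - tau G) * T G)).
      apply glue_first; try easy; lra.
  + set (e := Rmin (t - IZR k * T G) ((IZR k + tau G) * T G - t)).
    pose proof (Rmin_l (t - IZR k * T G) ((IZR k + tau G) * T G - t)) as M1.
    pose proof (Rmin_r (t - IZR k * T G) ((IZR k + tau G) * T G - t)) as M2.
    apply (continuous_piecewise _ (fun y => f1 (y - IZR k * T G))
      (fun y => f1 (y - IZR k * T G)) t e).
    * apply Rmin_pos; lra.
    * now apply continuous_shift.
    * now apply continuous_shift.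
    * intros y Hy; apply glue_first; try easy; unfold e in *; lra.
    * intros y Hy; apply glue_first; try easy; unfold e in *; lra.
- apply (continuous_piecewise _ (fun y => f1 (y - IZR k * T G))
      (fun y => f2 (y - IZR k * T G)) t (Rmin (tau G * T G) ((1 - tau G) * T G))).
  * now apply Rmin_pos.
  * now apply continuous_shift.
  * now apply continuous_shift.
  * intros y Hy; pose proof (Rmin_l (tau G * T G) ((1 - tau G) * T G)).
    apply glue_first; try easy; lra.
  * intros y Hy; pose proof (Rmin_r (tau G * T G) ((1 - tau G) * T G)).
    apply glue_second; try easy; lra.
- set (e := Rmin (t - (IZR k + tau G) * T G) ((IZR k + 1) * T G - t)).
  pose proof (Rmin_l (t - (IZR k + tau G) * T G) ((IZR k + 1) * T G - t)) as M1.
  pose proof (Rmin_r (t - (IZR k + tau G) * T G) ((IZR k + 1) * T G - t)) as M2.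
  apply (continuous_piecewise _ (fun y => f2 (y - IZR k * T G))
    (fun y => f2 (y - IZR k * T G)) t e).
  * apply Rmin_pos; lra.
  * now apply continuous_shift.
  * now apply continuous_shift.
  * intros y Hy; apply glue_second; try easy; unfold e in *; lra.
  * intros y Hy; apply glue_second; try easy; unfold e in *; lra.
Qed.

Lemma is_derive_shift_eq (f g : R -> R) (c t l e : R) :
  0 < e -> is_derive f (t - c) l ->
  (forall y, t - e < y < t + e -> g y = f (y - c)) ->
  is_derive g t l.
Proof.
intros He Hf Hg.
apply (is_derive_ext_loc (fun y => f (y - c))).
- exists (mkposreal e He); intros y Hy.
  apply Rabs_def2 in Hy; simpl in Hy.
  unfold minus, plus, opp in Hy; simpl in Hy.
  symmetry; apply Hg; lra.
- replace l with (scal 1 l) by apply Rmult_1_l.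
  apply (is_derive_comp f (fun y => y - c)); [exact Hf|].
  auto_derive; [easy|ring].
Qed.

(** Off the switching times, [t] is interior to a single branch, where the glued function is a
    translate of [f1] or [f2]. *)
Lemma glue_derive (G : game) (f1 f2 h1 h2 : R -> R) (t : R) :
  0 < T G -> 0 < tau G < 1 -> 0 < t -> ~ switching_time G t ->
  (forall s, is_derive f1 s (h1 s)) -> (forall s, is_derive f2 s (h2 s)) ->
  is_derive (glue G f1 f2) t (glue G h1 h2 t).
Proof.
intros HT Htau Ht Hsw D1 D2.
pose proof (period_index_bounds G t HT) as Hb.
(* [switching_time] is indexed by naturals, while the floor is an integer; positivity of [t] makes
   the floor nonnegative. *)
assert (Hk : exists n : nat, period_index G t = INR n).
{ assert (0 < period_index G t + 1) by nra.
  unfold period_index in *; rewrite <- plus_IZR in H; apply lt_IZR in H.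
  exists (Z.to_nat (Int_part (t / T G))).
  rewrite INR_IZR_INZ, Z2Nat.id; [easy|lia]. }
destruct Hk as [n Hn]; rewrite Hn in Hb.
assert (N1 : t <> INR n * T G) by (intros E; apply Hsw; exists n; now left).
assert (N2 : t <> (INR n + tau G) * T G)
  by (intros E; apply Hsw; exists n; now right).
unfold glue at 2; rewrite Hn.
destruct (Rlt_dec _ _) as [Hlt|Hge].
- set (e := Rmin (t - INR n * T G) ((INR n + tau G) * T G - t)).
  pose proof (Rmin_l (t - INR n * T G) ((INR n + tau G) * T G - t)) as M1.
  pose proof (Rmin_r (t - INR n * T G) ((INR n + tau G) * T G - t)) as M2.
  apply (is_derive_shift_eq f1 _ (INR n * T G) _ _ e); [apply Rmin_pos; lra|easy|].
  intros y Hy; unfold e in *; unfold glue.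
  rewrite (period_index_eq G n); [|easy|nra].
  destruct (Rlt_dec _ _); [easy|lra].
- set (e := Rmin (t - (INR n + tau G) * T G) ((INR n + 1) * T G - t)).
  pose proof (Rmin_l (t - (INR n + tau G) * T G) ((INR n + 1) * T G - t)) as M1.
  pose proof (Rmin_r (t - (INR n + tau G) * T G) ((INR n + 1) * T G - t)) as M2.
  apply (is_derive_shift_eq f2 _ (INR n * T G) _ _ e); [apply Rmin_pos; lra|easy|].
  intros y Hy; unfold e in *; unfold glue.
  rewrite (period_index_eq G n); [|easy|nra].
  destruct (Rlt_dec _ _); [lra|easy].
Qed.

(** * Constancy from a derivative that vanishes off the switching times *)

Lemma continuous_on_Rmax (f : R -> R) (x : R) :
  continuous_on (fun t => 0 <= t) f -> continuous (fun t => f (Rmax 0 t)) x.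
Proof.
intros Hf P HP.
specialize (Hf (Rmax 0 x) (Rmax_l 0 x) P HP).
destruct Hf as [e He]; exists e; intros y Hy.
apply He; [|apply Rmax_l].
apply Rabs_def2 in Hy; apply Rabs_def1;
  unfold minus, plus, opp in *; simpl in *;
  unfold Rmax; destruct (Rle_dec 0 y), (Rle_dec 0 x); pose proof (cond_pos e); lra.
Qed.

Lemma eq_of_derive_0 (f : R -> R) (u v : R) :
  continuous_on (fun t => 0 <= t) f -> 0 <= u <= v ->
  (forall x, u < x < v -> is_derive f x 0) -> f v = f u.
Proof.
intros Hc Huv Hd.
destruct (Req_dec u v) as [->|Hne]; [easy|].
(* The mean value theorem asks for two-sided continuity, also when [u] is 0. Composing with [Rmax 0]
   freezes the function to the left of 0 and changes nothing on the right. *)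
destruct (MVT_gen (fun t => f (Rmax 0 t)) u v (fun _ => 0)) as [c [_ Hc0]].
- rewrite Rmin_left, Rmax_right by lra; intros x Hx.
  apply (is_derive_ext_loc f); [|now apply Hd].
  assert (Hx0 : 0 < x) by lra.
  exists (mkposreal x Hx0); intros y Hy.
  apply Rabs_def2 in Hy; unfold minus, plus, opp in Hy; simpl in Hy.
  rewrite Rmax_right; [easy|lra].
- intros x _; apply continuity_pt_filterlim; now apply continuous_on_Rmax.
- rewrite !(Rmax_right 0) in Hc0 by lra; lra.
Qed.

(** Switching times are isolated, so constancy holds on each closed branch, passes through the
    switch by continuity, and then from period to period by induction. *)
Lemma constant_of_derive_0 (G : game) (f : R -> R) :
  0 < T G -> 0 < tau G < 1 -> continuous_on (fun t => 0 <= t) f ->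
  (forall t, 0 < t -> ~ switching_time G t -> is_derive f t 0) ->
  forall t, 0 <= t -> f t = f 0.
Proof.
intros HT Htau Hc Hd.
assert (Pt : 0 < tau G * T G < T G) by nra.
assert (Ksep : forall (n k : nat) (x : R), INR n * T G < x < (INR n + 1) * T G ->
  INR k * T G <= x < (INR k + 1) * T G -> INR k = INR n).
{ intros n k x H1 H2.
  rewrite <- (period_index_eq G k x), <- (period_index_eq G n x); (easy || lra). }
assert (Hsw : forall (n : nat) (x : R), INR n * T G < x < (INR n + 1) * T G ->
  x <> (INR n + tau G) * T G -> ~ switching_time G x).
{ intros n x H1 H2 [k [E|E]];
    assert (Ek : INR k = INR n) by (apply (Ksep n k x); lra);
    rewrite Ek in E; lra. }
assert (Hpos : forall n : nat, 0 <= INR n * T G)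
  by (intros n; pose proof (pos_INR n); nra).
assert (Step1 : forall (n : nat) (x : R),
  INR n * T G <= x <= (INR n + tau G) * T G -> f x = f (INR n * T G)).
{ intros n x Hx; pose proof (Hpos n); apply eq_of_derive_0; [easy|lra|].
  intros y Hy; apply Hd; [lra|apply (Hsw n); lra]. }
assert (Step2 : forall (n : nat) (x : R),
  INR n * T G <= x <= (INR n + 1) * T G -> f x = f (INR n * T G)).
{ intros n x Hx; pose proof (Hpos n).
  destruct (Rle_dec x ((INR n + tau G) * T G)); [apply Step1; lra|].
  rewrite <- (Step1 n ((INR n + tau G) * T G)) by lra.
  apply eq_of_derive_0; [easy|lra|].
  intros y Hy; apply Hd; [lra|apply (Hsw n); lra]. }
assert (Step3 : forall n : nat, f (INR n * T G) = f 0).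
{ induction n as [|n IH]; [now rewrite Rmult_0_l|].
  rewrite S_INR, <- IH; apply Step2; lra. }
intros t Ht.
destruct (nfloor_ex (t / T G)) as [n Hn].
{ apply Rle_mult_inv_pos; lra. }
assert (E : t / T G * T G = t) by (field; lra).
rewrite <- (Step3 n); apply Step2; rewrite <- E; nra.
Qed.

(** * The accumulated decay and its linear growth *)

Definition mean_delta (G : game) : R :=
  tau G * delta1 G + (1 - tau G) * delta2 G.

(** The integral of [delta] over [[0, t]], split into a linear and a periodic
    part. *)
Definition decay (G : game) (t : R) : R :=
  mean_delta G * t +
  glue G (fun s => (delta1 G - mean_delta G) * s)
         (fun s => (delta2 G - mean_delta G) * (s - T G)) t.

(** The junction at the switch holds exactly because [mean_delta] is the time average of [delta]; at
    the period end both branches vanish. *)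
Lemma decay_glueable (G : game) :
  glueable G (fun s => (delta1 G - mean_delta G) * s)
             (fun s => (delta2 G - mean_delta G) * (s - T G)).
Proof. unfold glueable, mean_delta; split; ring. Qed.

Lemma decay_continuous (G : game) (t : R) :
  0 < T G -> 0 < tau G < 1 -> continuous (decay G) t.
Proof.
intros HT Htau; apply (continuous_plus (V := R_NormedModule)).
- apply (ex_derive_continuous (V := R_NormedModule)); auto_derive; easy.
- apply glue_continuous; [easy|easy|apply decay_glueable| |];
    intros s; apply (ex_derive_continuous (V := R_NormedModule));
    auto_derive; easy.
Qed.

Lemma decay_derive (G : game) (t : R) :
  0 < T G -> 0 < tau G < 1 -> 0 < t -> ~ switching_time G t ->
  is_derive (decay G) t (delta G t).
Proof.
intros HT Htau Ht Hsw.
replace (delta G t) with (mean_delta G +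
  glue G (fun _ => delta1 G - mean_delta G) (fun _ => delta2 G - mean_delta G) t)
  by (unfold glue, delta; destruct (Rlt_dec _ _); ring).
apply (is_derive_plus (V := R_NormedModule)).
- auto_derive; [easy|ring].
- apply glue_derive; try easy; intros s; auto_derive; (easy || ring).
Qed.

Lemma decay_0 (G : game) : 0 < T G -> 0 < tau G < 1 -> decay G 0 = 0.
Proof.
intros HT Htau; unfold decay.
rewrite (glue_first G _ _ 0); [ring|easy|easy|apply decay_glueable|nra].
Qed.

Lemma decay_T (G : game) :
  0 < T G -> 0 < tau G < 1 -> decay G (T G) = mean_delta G * T G.
Proof.
intros HT Htau; unfold decay.
rewrite (glue_second G _ _ 0); [ring|easy|easy|apply decay_glueable|nra].
Qed.

Lemma mean_delta_pos (G : game) :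
  0 < tau G < 1 -> 0 < delta1 G -> 0 < delta2 G -> 0 < mean_delta G.
Proof. intros; unfold mean_delta; nra. Qed.

(** The periodic part is bounded, so it costs only a constant factor in [exp (- decay G t)] and
    leaves the exponential rate [mean_delta G]. *)
Lemma decay_lower_bound (G : game) :
  0 < T G -> exists M : R, forall t : R, mean_delta G * t - M <= decay G t.
Proof.
intros HT.
exists ((Rabs (delta1 G - mean_delta G) + Rabs (delta2 G - mean_delta G)) * T G).
intros t; unfold decay.
match goal with |- _ - ?M <= _ + ?g => assert (H : Rabs g <= M) end.
{ pose proof (Rabs_pos (delta1 G - mean_delta G)).
  pose proof (Rabs_pos (delta2 G - mean_delta G)).
  apply glue_bounded; [easy| |]; intros s Hs; rewrite Rabs_mult.
  - rewrite (Rabs_pos_eq s) by lra; nra.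
  - rewrite (Rabs_left1 (s - T G)) by lra; nra. }
apply Rabs_le_between in H; lra.
Qed.

(** * Comparison of trajectories *)

Lemma continuous_on_of_continuous (D : R -> Prop) (f : R -> R) :
  (forall x, continuous f x) -> continuous_on D f.
Proof. intros Hf x _; apply filterlim_within_ext with f; [easy|].
apply (filterlim_filter_le_1 f (filter_le_within _)); apply Hf.
Qed.

(** The eta-expanded form in which [auto_derive] leaves unknown derivatives. *)
Lemma Derive_of_is_derive (f : R -> R) (x l : R) :
  is_derive f x l -> Derive (fun y : R => f y) x = l.
Proof. apply is_derive_unique. Qed.

Lemma trajectory_difference (G : game) (pi : coalition_structure) (w z : R -> R) :
  0 < T G -> 0 < tau G < 1 ->
  is_trajectory G pi w -> is_trajectory G pi z ->
  forall t, 0 <= t -> w t - z t = (w 0 - z 0) * exp (- decay G t).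
Proof.
intros HT Htau [Cw Dw] [Cz Dz] t Ht.
assert (H : (w t - z t) * exp (decay G t) = (w 0 - z 0) * exp (decay G 0)).
{ apply (constant_of_derive_0 G (fun x => (w x - z x) * exp (decay G x)));
    try easy.
  - intros x Hx.
    apply (filterlim_comp_2 (G := locally (w x - z x))
      (H := locally (exp (decay G x)))).
    + apply (filterlim_comp_2 (G := locally (w x)) (H := locally (opp (z x)))
        w (fun y => opp (z y)) Rplus).
      * now apply Cw.
      * exact (filterlim_comp _ _ _ z opp _ _ _ (Cz x Hx)
          (filterlim_opp (V := R_NormedModule) (z x))).
      * apply (filterlim_plus (V := R_NormedModule)).
    + apply (continuous_on_of_continuous (fun t => 0 <= t)
        (fun x => exp (decay G x))); [|easy].
      intros y; apply (continuous_comp (decay G) exp).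
      * now apply decay_continuous.
      * apply (ex_derive_continuous (V := R_NormedModule)); auto_derive; easy.
    + apply (filterlim_mult (K := R_AbsRing)).
  - intros x Hx Hsw.
    assert (Dd := decay_derive G x HT Htau Hx Hsw).
    specialize (Dw x Hx Hsw); specialize (Dz x Hx Hsw).
    auto_derive.
    + repeat split; eexists; eassumption.
    + rewrite (Derive_of_is_derive w x _ Dw),
        (Derive_of_is_derive z x _ Dz),
        (Derive_of_is_derive (decay G) x _ Dd).
      (* The strategy terms are common to both trajectories and cancel; the remaining
         [- delta G x * (w x - z x)] is offset by the derivative of the exponential. *)
      unfold rhs; ring. }
rewrite decay_0, exp_0 in H by easy.
rewrite exp_Ropp, <- (Rmult_1_r (w 0 - z 0)), <- H.
field; apply Rgt_not_eq, exp_pos.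
Qed.

(** The added term solves the homogeneous equation. Hence a single trajectory yields one for every
    initial value. *)
Lemma trajectory_shift (G : game) (pi : coalition_structure) (z : R -> R) (c : R) :
  0 < T G -> 0 < tau G < 1 -> is_trajectory G pi z ->
  is_trajectory G pi (fun t => z t + c * exp (- decay G t)).
Proof.
intros HT Htau [Cz Dz]; split.
- intros x Hx.
  apply (filterlim_comp_2 (G := locally (z x))
    (H := locally (c * exp (- decay G x)))).
  + now apply Cz.
  + apply (continuous_on_of_continuous (fun t => 0 <= t)
      (fun x => c * exp (- decay G x))); [|easy].
    intros y; apply (continuous_comp (decay G) (fun d => c * exp (- d))).
    * now apply decay_continuous.
    * apply (ex_derive_continuous (V := R_NormedModule)); auto_derive; easy.
  + apply (filterlim_plus (V := R_NormedModule)).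
- intros x Hx Hsw.
  assert (Dd := decay_derive G x HT Htau Hx Hsw); specialize (Dz x Hx Hsw).
  auto_derive.
  + repeat split; eexists; eassumption.
  + rewrite (Derive_of_is_derive z x _ Dz),
      (Derive_of_is_derive (decay G) x _ Dd).
    unfold rhs; ring.
Qed.

(** * Explicit construction of the limit cycle *)

Definition half_period_solution (A B m s d g x : R) : R :=
  (A - B / s) / d + B * m / (s + d) * exp (s * x) + g * exp (- d * x).

(** The three summands are the response to the constant forcing, the response to the exponential
    forcing, and a homogeneous solution with free coefficient [g]. *)
Lemma half_period_solution_derive (A B m s d g x : R) :
  s <> 0 -> d <> 0 -> s + d <> 0 ->
  is_derive (half_period_solution A B m s d g) x
    (A + B * (m * exp (s * x) - 1 / s) - d * half_period_solution A B m s d g x).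
Proof.
intros Hs Hd Hsd; unfold half_period_solution.
auto_derive; [easy|field; easy].
Qed.

Lemma half_period_solutions_glueable (G : game) (A B : R) :
  0 < T G -> 0 < tau G < 1 -> 0 < delta1 G -> 0 < delta2 G ->
  exists g1 g2 : R,
    glueable G (half_period_solution A B (m1 G) (s1 G) (delta1 G) g1)
               (half_period_solution A B (m2 G) (s2 G) (delta2 G) g2).
Proof.
intros HT Htau Hd1 Hd2.
set (p1 := half_period_solution A B (m1 G) (s1 G) (delta1 G) 0).
set (p2 := half_period_solution A B (m2 G) (s2 G) (delta2 G) 0).
set (x := exp (- delta1 G * (tau G * T G))).
set (y := exp (- delta2 G * (tau G * T G))).
set (w := exp (- delta2 G * T G)).
assert (Pt : 0 < tau G * T G < T G) by nra.
assert (Hx : x < 1).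
{ rewrite <- exp_0; apply exp_increasing; nra. }
assert (Hx0 : 0 < x) by apply exp_pos.
assert (Hw0 : 0 < w) by apply exp_pos.
assert (Hwy : w < y) by (apply exp_increasing; nra).
(* Here [w * x < w < y], so the linear system for the two free constants is nonsingular. *)
assert (Hdet : w * x - y <> 0) by nra.
set (e1 := p2 (tau G * T G) - p1 (tau G * T G)).
set (e2 := p1 0 - p2 (T G)).
(* The junctions read [g1 * x - g2 * y = e1] and [g2 * w - g1 = e2]; eliminating [g1] gives this
   value. *)
set (g2 := (e1 + e2 * x) / (w * x - y)).
exists (g2 * w - e2), g2.
assert (S1 : forall g s,
  half_period_solution A B (m1 G) (s1 G) (delta1 G) g s
  = p1 s + g * exp (- delta1 G * s))
  by (intros; unfold p1, half_period_solution; ring).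
assert (S2 : forall g s,
  half_period_solution A B (m2 G) (s2 G) (delta2 G) g s
  = p2 s + g * exp (- delta2 G * s))
  by (intros; unfold p2, half_period_solution; ring).
split; rewrite S1, S2.
- fold x y.
  enough (g2 * (w * x - y) = e1 + e2 * x) by (unfold e1 in *; lra).
  unfold g2; field; easy.
- rewrite Rmult_0_r, exp_0; fold w; unfold e2; ring.
Qed.

Lemma limit_cycle_exists (G : game) (pi : coalition_structure) :
  0 < T G -> 0 < tau G < 1 -> 0 < rho G -> 0 < delta1 G -> 0 < delta2 G ->
  exists z : R -> R, is_hybrid_limit_cycle G pi z.
Proof.
intros HT Htau Hr Hd1 Hd2.
(* The total emission is affine in [L]: it equals [A + B * L G t]. *)
set (A := xi G P1 * b G P1 + xi G P2 * b G P2 + xi G P3 * b G P3).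
set (B := xi G P1 * (xi G P1 / a G P1 * coeff G pi P1)
        + xi G P2 * (xi G P2 / a G P2 * coeff G pi P2)
        + xi G P3 * (xi G P3 / a G P3 * coeff G pi P3)).
destruct (half_period_solutions_glueable G A B) as [g1 [g2 Hg]]; try easy.
set (f1 := half_period_solution _ _ _ _ _ g1) in Hg.
set (f2 := half_period_solution _ _ _ _ _ g2) in Hg.
assert (D1 : forall s, is_derive f1 s
  (A + B * (m1 G * exp (s1 G * s) - 1 / s1 G) - delta1 G * f1 s))
  by (intros s; apply half_period_solution_derive; unfold s1; lra).
assert (D2 : forall s, is_derive f2 s
  (A + B * (m2 G * exp (s2 G * s) - 1 / s2 G) - delta2 G * f2 s))
  by (intros s; apply half_period_solution_derive; unfold s2; lra).
exists (glue G f1 f2); split; [split|].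
- apply continuous_on_of_continuous; intros t; apply glue_continuous; try easy;
    intros s; apply (ex_derive_continuous (V := R_NormedModule));
    eexists; [apply D1|apply D2].
- intros t Ht Hsw.
  replace (rhs G pi t (glue G f1 f2 t)) with (glue G
    (fun s => A + B * (m1 G * exp (s1 G * s) - 1 / s1 G) - delta1 G * f1 s)
    (fun s => A + B * (m2 G * exp (s2 G * s) - 1 / s2 G) - delta2 G * f2 s) t).
  + now apply glue_derive.
  (* [delta], [L] and [glue] branch on the same test, so one case split leaves ring identities. *)
  + unfold rhs, strategy, delta, L, glue, A, B.
    destruct (Rlt_dec _ _); ring.
- intros t _; now apply glue_periodic.
Qed.

Theorem theorem1 (G : game) (pi : coalition_structure)
  (ha : forall i : player, 0 < a G i)
  (hb : forall i : player, 0 < b G i)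
  (hxi : forall i : player, 0 < xi G i)
  (hq1 : 0 < q1 G) (hq2 : 0 < q2 G)
  (hrho : 0 < rho G) (hT : 0 < T G)
  (htau : 0 < tau G < 1)
  (hdelta1 : 0 < delta1 G) (hdelta2 : 0 < delta2 G)
  (hsust : environmentally_sustainable G) :
  exists zbar : R -> R,
    is_hybrid_limit_cycle G pi zbar /\
    (forall w : R -> R, is_hybrid_limit_cycle G pi w ->
       forall t : R, 0 <= t -> w t = zbar t) /\
    (forall z0 : R, 0 <= z0 ->
       exists z : R -> R,
         (is_trajectory G pi z /\ z 0 = z0) /\
         (forall w : R -> R, is_trajectory G pi w -> w 0 = z0 ->
            forall t : R, 0 <= t -> w t = z t) /\
         converges_exponentially z zbar).
Proof.
destruct (limit_cycle_exists G pi) as [zbar Hz]; try easy.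
assert (Hmu := mean_delta_pos G htau hdelta1 hdelta2).
exists zbar; split; [easy|]; destruct Hz as [Tz Pz]; split.
- intros w [Tw Pw] t Ht.
  assert (Hd := trajectory_difference G pi w zbar hT htau Tw Tz).
  (* Over one period the difference is multiplied by a factor below 1, yet periodicity keeps it
     unchanged; so it vanishes at 0. *)
  assert (H0 : w 0 - zbar 0 = 0).
  { assert (HT := Hd (T G) ltac:(lra)).
    assert (w (T G) = w 0) by (rewrite <- (Pw 0), Rplus_0_l by lra; easy).
    assert (zbar (T G) = zbar 0) by (rewrite <- (Pz 0), Rplus_0_l by lra; easy).
    rewrite decay_T in HT by easy.
    assert (exp (- (mean_delta G * T G)) < 1)
      by (rewrite <- exp_0; apply exp_increasing; nra).
    nra. }
  specialize (Hd t Ht); rewrite H0 in Hd; lra.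
- intros z0 _.
  (* The limit cycle is corrected by the homogeneous solution that makes up the initial gap, since
     [decay G 0 = 0]. *)
  exists (fun t => zbar t + (z0 - zbar 0) * exp (- decay G t)).
  assert (Ts := trajectory_shift G pi zbar (z0 - zbar 0) hT htau Tz).
  assert (E0 : zbar 0 + (z0 - zbar 0) * exp (- decay G 0) = z0)
    by (rewrite decay_0, Ropp_0, exp_0 by easy; ring).
  split; [easy|split].
  + intros w Tw Hw t Ht.
    pose proof (trajectory_difference G pi _ _ hT htau Tw Ts t Ht) as Hd.
    simpl in Hd; rewrite E0, Hw in Hd; lra.
  + destruct (decay_lower_bound G hT) as [M HM].
    exists (Rabs (z0 - zbar 0) * exp M), (mean_delta G).
    pose proof (Rabs_pos (z0 - zbar 0)); pose proof (exp_pos M).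
    split; [nra|split; [easy|]].
    intros t Ht.
    replace (zbar t + (z0 - zbar 0) * exp (- decay G t) - zbar t)
      with ((z0 - zbar 0) * exp (- decay G t)) by ring.
    rewrite Rabs_mult, (Rabs_pos_eq (exp _)) by (left; apply exp_pos).
    rewrite Rmult_assoc, <- exp_plus.
    apply Rmult_le_compat_l; [easy|].
    specialize (HM t).
    destruct (Rle_lt_or_eq_dec (- decay G t) (M + - mean_delta G * t))
      as [Hlt|Heq]; [lra|now left; apply exp_increasing|now rewrite Heq; right].
Qed.
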